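(* Let $P$ be a set of $n$ points in general position in the plane and let $F$ be a family of convex pseudo-discs of $P$. If no member of $F$ is contained in another, then $F$ consists of at most $4\binom{n}{2}+1$ members.
   Context: A set of points in the plane $\mathbb{R}^2$ is in general position if no three of its points are collinear. Let $\mathrm{conv}(A)$ denote the convex hull of $A$. A family $F$ of subsets of $P$ is called a family of convex pseudo-discs (of $P$) if: (1) every set in $F$ is the intersection of $P$ with a convex set; and (2) if $A$ and $B$ are two different sets in $F$, then both sets $\mathrm{conv}(A)\setminus\mathrm{conv}(B)$ and $\mathrm{conv}(B)\setminus\mathrm{conv}(A)$ are connected (or empty). *)

(* Defs.v *)
From HB Require Import structures.
From mathcomp Require Import all_boot all_order all_algebra.
From mathcomp Require Import all_classical all_reals all_analysis.

Set Implicit Arguments.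
Unset Strict Implicit.
Unset Printing Implicit Defensive.

Import Order.TTheory GRing.Theory Num.Theory.
Import numFieldNormedType.Exports.

Local Open Scope classical_set_scope.
Local Open Scope ring_scope.

Definition collinear (R : realType) (S : set 'rV[R]_2) : Prop :=
  exists p v : 'rV[R]_2,
    v != 0 /\ forall x, S x -> exists t : R, x = p + t *: v.

(* [set a; b; c] only has three points when a, b and c are distinct, and any
   two points are collinear. *)
Definition general_position (R : realType) (P : set 'rV[R]_2) : Prop :=
  forall a b c : 'rV[R]_2, P a -> P b -> P c ->
    a != b -> b != c -> a != c -> ~ collinear [set a; b; c].

Definition conv_hull (R : realType) (A : set 'rV[R]_2) : set 'rV[R]_2 :=
  smallest (@convex_set R 'rV[R]_2) A.

(* Here the empty set counts as connected (lemma connected0). *)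
Definition convex_pseudo_discs (R : realType) (P : set 'rV[R]_2)
    (F : set (set 'rV[R]_2)) : Prop :=
  (forall A, F A -> exists2 C, @convex_set R 'rV[R]_2 C & A = P `&` C) /\
  (forall A B, F A -> F B -> A <> B ->
    connected (conv_hull A `\` conv_hull B) /\
    connected (conv_hull B `\` conv_hull A)).

(* Main.v *)
Require Import Defs.
From HB Require Import structures.
From mathcomp Require Import all_boot all_order all_algebra.
From mathcomp Require Import all_classical all_reals all_analysis.
From mathcomp Require Import ring lra zify.

(* For distinct A, B in F, going counterclockwise around the convex hull of
   A U B there is exactly one edge xy that passes from x in A \ B to y in B.
   One exists because neither A \ B nor B \ A is swallowed by the other hull.
   If xy and x'y' were two such edges, x y x' y' would be a convex
   quadrilateral whose diagonal yy' lies in conv B and separates x from x' in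
   conv A, so conv A \ conv B would be disconnected.  For A = B there is no such
   edge.  Thus the matrix J - I of size |F| is the product of two incidence
   matrices, (A, xy) recording "x in A and A is left of xy" and (xy, B) recording
   "y in B, x not in B and B is left of xy".  When |F| > 1 it is invertible, so
   |F| is at most the number n^2 of ordered pairs, and n^2 <= 4 C(n, 2) + 1. *)

Set Implicit Arguments.
Unset Strict Implicit.
Unset Printing Implicit Defensive.

Import Order.TTheory GRing.Theory Num.Theory.
Import numFieldNormedType.Exports.

Local Open Scope classical_set_scope.
Local Open Scope ring_scope.
Local Open Scope card_scope.

(** * Least elements of finite lists and coordinates in the plane *)

Lemma seq_least (T : eqType) (r : rel T) (s : seq T) :
  s != [::] -> {in s &, total r} -> {in s & &, transitive r} ->
  exists2 m, m \in s & {in s, forall x, r m x}.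
Proof.
elim: s => // a [|b s] IHs _ r_tot r_trans.
  exists a; rewrite ?mem_head// => x; rewrite mem_seq1 => /eqP ->.
  by have /orP[] := r_tot a a (mem_head _ _) (mem_head _ _).
have sub x : x \in b :: s -> x \in [:: a, b & s] by move=> xs; rewrite in_cons xs orbT.
have aa := mem_head a (b :: s).
have [//||| m ms m_min] := IHs.
- by move=> x y xs ys; apply: r_tot; apply: sub.
- by move=> y x z ys xs zs; apply: r_trans; apply: sub.
have /orP[ram|rma] := r_tot a m aa (sub _ ms).
- exists a => // x; rewrite in_cons => /orP[/eqP->|xs].
    by have /orP[] := r_tot a a aa aa.
  exact: (r_trans m a x (sub _ ms) aa (sub _ xs) ram (m_min _ xs)).
- exists m; first exact: sub.
  by move=> x; rewrite in_cons => /orP[/eqP->|xs] //; exact: m_min.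
Qed.

Lemma rV2_eq (R : realType) (p q : 'rV[R]_2) : p 0 0 = q 0 0 -> p 0 1 = q 0 1 -> p = q.
Proof.
move=> e0 e1; apply/rowP => -[[|[|//]] i2].
- by rewrite (_ : Ordinal i2 = 0) //; apply: val_inj.
- by rewrite (_ : Ordinal i2 = 1) //; apply: val_inj.
Qed.

Lemma sumsq_gt0 (R : realFieldType) (x y : R) : ~ (x = 0 /\ y = 0) -> 0 < x * x + y * y.
Proof.
move=> xy; rewrite lt_neqAle addr_ge0 ?sqr_ge0 -?expr2 ?sqr_ge0// andbT.
apply/eqP => e; apply: xy; move/eqP: (esym e).
by rewrite paddr_eq0 ?sqr_ge0// !sqrf_eq0 => /andP[/eqP-> /eqP->].
Qed.

Lemma psum3_eq0 (R : realFieldType) (a b c : R) : 0 <= a -> 0 <= b -> 0 <= c ->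
  a + b + c = 0 -> [/\ a = 0, b = 0 & c = 0].
Proof. by move=> *; split; lra. Qed.

(** Twice the signed area of the triangle [p q r], positive when [r] is strictly left of the
    directed line [p q]. *)
Definition orient (R : realType) (p q r : 'rV[R]_2) : R :=
  (q 0 0 - p 0 0) * (r 0 1 - p 0 1) - (q 0 1 - p 0 1) * (r 0 0 - p 0 0).

Lemma orient_anti (R : realType) (p q r : 'rV[R]_2) : orient p q r = - orient p r q.
Proof. by rewrite /orient; ring. Qed.

(* By Caratheodory's theorem, [p] lies outside the convex hull of the points
   indexed by [A]. *)
Definition pointed (R : realType) (T : finType) (pt : T -> 'rV[R]_2) (p : 'rV[R]_2)
    (A : {set T}) : Prop :=
  forall j k l (c1 c2 c3 : R), j \in A -> k \in A -> l \in A ->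
    0 <= c1 -> 0 <= c2 -> 0 <= c3 -> 0 < c1 + c2 + c3 ->
    c1 * (pt j 0 0 - p 0 0) + c2 * (pt k 0 0 - p 0 0) + c3 * (pt l 0 0 - p 0 0) = 0 ->
    c1 * (pt j 0 1 - p 0 1) + c2 * (pt k 0 1 - p 0 1) + c3 * (pt l 0 1 - p 0 1) = 0 ->
    False.

(** * Angular order around a point and separation by a line *)

Section Geometry.
Variables (R : realType) (T : finType) (pt : T -> 'rV[R]_2).

(** Three plane vectors satisfy a linear relation whose coefficients are their pairwise
    orientations; a failure of transitivity would make these nonnegative and not all zero. As the
    angular order is transitive only on such sets, [seq_least] asks for transitivity on the list
    alone. *)
Lemma pointed_trans (p : 'rV[R]_2) (A : {set T}) : pointed pt p A ->
  {in A & &, transitive (fun i j => 0 <= orient p (pt i) (pt j))}.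
Proof.
move=> ptd k j l kA jA lA jk kl; rewrite leNgt; apply/negP => jl.
apply: (ptd j k l (orient p (pt k) (pt l)) (- orient p (pt j) (pt l))
  (orient p (pt j) (pt k)) jA kA lA kl _ jk); rewrite /orient; rewrite /orient in jk kl jl; [lra|lra|ring|ring].
Qed.

Lemma pointed_right (p : 'rV[R]_2) (A : {set T}) : pointed pt p A -> A != finset.set0 ->
  exists2 m, m \in A & {in A, forall j, 0 <= orient p (pt m) (pt j)}.
Proof.
move=> ptd A0.
have [||| m ms mP] := @seq_least T (fun i j => 0 <= orient p (pt i) (pt j)) (enum A).
- by apply: contraNneq A0 => e; rewrite -finset.cards_eq0 cardE e.
- move=> i j _ _; rewrite (orient_anti p (pt j)); lra.
- by move=> i j k; rewrite !mem_enum; exact: pointed_trans.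
by exists m; [rewrite mem_enum in ms | move=> j jA; apply: mP; rewrite mem_enum].
Qed.

Lemma pointed_left (p : 'rV[R]_2) (A : {set T}) : pointed pt p A -> A != finset.set0 ->
  exists2 m, m \in A & {in A, forall j, 0 <= orient p (pt j) (pt m)}.
Proof.
move=> ptd A0.
have [||| m ms mP] := @seq_least T (fun i j => 0 <= orient p (pt j) (pt i)) (enum A).
- by apply: contraNneq A0 => e; rewrite -finset.cards_eq0 cardE e.
- move=> i j _ _; rewrite (orient_anti p (pt j)); lra.
- move=> i j k; rewrite !mem_enum => iA jA kA ij ki; exact: (pointed_trans ptd iA).
by exists m; [rewrite mem_enum in ms | move=> j jA; apply: mP; rewrite mem_enum].
Qed.

(** Seen from [p], the set lies between its extreme rays, through [pt m] and [pt M]. If these span a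
    positive angle, the sum of their inner normals separates; otherwise all points lie on one ray,
    whose direction separates. *)
Lemma pointed_separation (p : 'rV[R]_2) (A : {set T}) : pointed pt p A ->
  exists a b : R, {in A, forall j, 0 < a * (pt j 0 0 - p 0 0) + b * (pt j 0 1 - p 0 1)}.
Proof.
move=> ptd; have [->|A0] := eqVneq A finset.set0.
  by exists 0, 0 => j; rewrite inE.
have [m mA mP] := pointed_right ptd A0.
have [M MA MP] := pointed_left ptd A0.
have nz j : j \in A -> ~ (pt j 0 0 - p 0 0 = 0 /\ pt j 0 1 - p 0 1 = 0).
  by move=> jA [e0 e1]; apply: (ptd j j j 1 0 0); rewrite ?e0 ?e1//; lra.
set u := pt m 0 0 - p 0 0; set v := pt m 0 1 - p 0 1.
set U := pt M 0 0 - p 0 0; set V := pt M 0 1 - p 0 1.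
have [mM|mM] := ltP 0 (orient p (pt m) (pt M)).
  (* The functional is the orientation of [m], [j] plus that of [j], [M]; both are nonnegative and
     vanish together only at [p]. *)
  exists (V - v), (u - U) => j jA.
  have := mP j jA; have := MP j jA; move: mM; have := nz j jA; rewrite /orient -/u -/v -/U -/V.
  set x := pt j 0 0 - p 0 0; set y := pt j 0 1 - p 0 1 => xy0 mM h1 h2.
  rewrite lt_neqAle; apply/andP; split; last lra.
  apply/eqP => e; apply: xy0.
  have e1 : u * y - v * x = 0 by lra.
  have e2 : x * V - y * U = 0 by lra.
  have ex : x * (u * V - v * U) = 0.
    transitivity ((u * y - v * x) * U + u * (x * V - y * U)); [ring|rewrite e1 e2; ring].
  have ey : y * (u * V - v * U) = 0.
    transitivity ((u * y - v * x) * V + v * (x * V - y * U)); [ring|rewrite e1 e2; ring].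
  move/eqP: ex; move/eqP: ey; rewrite !mulf_eq0 (gt_eqF mM) !orbF => /eqP-> /eqP->//.
have {mM} mM : u * V - v * U = 0.
  by have := mP M MA; move: mM; rewrite /orient -/u -/v -/U -/V; lra.
have uv := nz m mA; have UV := nz M MA; rewrite -/u -/v -/U -/V in uv UV.
have N : 0 < u * u + v * v := sumsq_gt0 uv.
(* If the parallel vectors to [m] and [M] were opposite, a positive combination of them would
   vanish. *)
have D : 0 < u * U + v * V.
  rewrite ltNge; apply/negP => D.
  apply: (ptd m m M 0 (- (u * U + v * V)) (u * u + v * v)) => //; rewrite -/u -/v -/U -/V; try lra.
  - transitivity (v * (v * U - u * V)); [ring|]. by rewrite -opprB mM; ring.
  - transitivity (u * (u * V - v * U)); [ring|]. by rewrite mM; ring.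
exists u, v => j jA.
have := mP j jA; have := MP j jA; have := nz j jA; rewrite /orient -/u -/v -/U -/V.
set x := pt j 0 0 - p 0 0; set y := pt j 0 1 - p 0 1 => xy0 h1 h2.
have e : u * y - v * x = 0.
  apply/eqP; rewrite eq_le h2 andbT.
  have : (u * y - v * x) * (u * U + v * V) <= 0.
    have -> : (u * y - v * x) * (u * U + v * V) =
       - (u * u + v * v) * (x * V - y * U) + (u * V - v * U) * (u * x + v * y) by ring.
    rewrite mM mul0r addr0 mulNr oppr_le0 mulr_ge0// ltW//.
  by rewrite pmulr_lle0.
rewrite ltNge; apply/negP => h.
apply: (ptd m m j 0 (- (u * x + v * y)) (u * u + v * v)) => //; rewrite -/u -/v -/x -/y; try lra.
- transitivity (- v * (u * y - v * x)); [ring|]. by rewrite e; ring.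
- transitivity (u * (u * y - v * x)); [ring|]. by rewrite e; ring.
Qed.

End Geometry.

Section Existence.
Variables (R : realType) (T : finType) (pt : T -> 'rV[R]_2).
Hypothesis pt_inj : injective pt.
Hypothesis pt_gen : forall i j k, i != j -> j != k -> i != k ->
  orient (pt i) (pt j) (pt k) != 0.

(** In a vanishing combination the first functional leaves weight only on its zero line, and the
    second, negative there, removes that too. This lets points lie on the supporting line through
    [p], on one side of [p]. *)
Lemma lex_pointed (p : 'rV[R]_2) (A : {set T}) (v w : R) :
  {in A, forall j, let x := pt j 0 0 - p 0 0 in let y := pt j 0 1 - p 0 1 in
     0 < v * y - w * x \/ (v * y - w * x = 0 /\ v * x + w * y < 0)} ->
  pointed pt p A.
Proof.
move=> H j k l c1 c2 c3 jA kA lA h1 h2 h3 h.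
move: (H j jA) (H k kA) (H l lA) => /=.
set x1 := pt j 0 0 - p 0 0; set y1 := pt j 0 1 - p 0 1.
set x2 := pt k 0 0 - p 0 0; set y2 := pt k 0 1 - p 0 1.
set x3 := pt l 0 0 - p 0 0; set y3 := pt l 0 1 - p 0 1.
move=> H1 H2 H3 e1 e2.
have G (c d s : R) : 0 <= c -> 0 < d \/ (d = 0 /\ s < 0) ->
    0 <= c * d /\ (c * d = 0 -> 0 <= - (c * s) /\ (- (c * s) = 0 -> c = 0)).
  move=> c0 [d0|[-> s0]].
    split; first by rewrite mulr_ge0 // ltW.
    by move/eqP; rewrite mulf_eq0 (gt_eqF d0) orbF => /eqP->; rewrite mul0r oppr0.
  rewrite mulr0; split=> // _; split; first by rewrite oppr_ge0 mulr_ge0_le0 // ltW.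
  by move/eqP; rewrite oppr_eq0 mulf_eq0 (lt_eqF s0) orbF => /eqP->.
have [a1 b1] := G _ _ _ h1 H1; have [a2 b2] := G _ _ _ h2 H2; have [a3 b3] := G _ _ _ h3 H3.
have eD : c1 * (v * y1 - w * x1) + c2 * (v * y2 - w * x2) + c3 * (v * y3 - w * x3) = 0.
  transitivity (v * (c1 * y1 + c2 * y2 + c3 * y3) - w * (c1 * x1 + c2 * x2 + c3 * x3)); first by ring.
  by rewrite e1 e2; ring.
have eS : c1 * (v * x1 + w * y1) + c2 * (v * x2 + w * y2) + c3 * (v * x3 + w * y3) = 0.
  transitivity (v * (c1 * x1 + c2 * x2 + c3 * x3) + w * (c1 * y1 + c2 * y2 + c3 * y3)); first by ring.
  by rewrite e1 e2; ring.
have [/b1[u1 z1] /b2[u2 z2] /b3[u3 z3]] := psum3_eq0 a1 a2 a3 eD.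
have [|/z1 d1 /z2 d2 /z3 d3] := psum3_eq0 u1 u2 u3; first by rewrite -!opprD eS oppr0.
by move: h; rewrite d1 d2 d3 !addr0 ltxx.
Qed.

Lemma pt_neq (i j : T) : i != j -> ~ (pt j 0 0 - pt i 0 0 = 0 /\ pt j 0 1 - pt i 0 1 = 0).
Proof.
move=> /eqP ij [e0 e1]; apply: ij; apply: pt_inj.
by apply: rV2_eq; apply/eqP; rewrite eq_sym -subr_eq0 ?e0 ?e1.
Qed.

(** The end of a hull edge is again a hull vertex: general position puts every other point strictly
    left of the edge, except [pt i], which is behind [pt j] on its line. *)
Lemma successor_pointed (i j : T) (A : {set T}) : i != j ->
  {in A, forall k, 0 <= orient (pt i) (pt j) (pt k)} ->
  pointed pt (pt j) (A :\ j)%SET.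
Proof.
move=> ij ijA.
apply: (@lex_pointed _ _ (pt j 0 0 - pt i 0 0) (pt j 0 1 - pt i 0 1)) => k.
rewrite finset.in_setD1 => /andP[kj kA] /=.
have [->|ki] := eqVneq k i.
  right; split; first by ring.
  have := sumsq_gt0 (pt_neq ij); lra.
left; have := ijA k kA; rewrite le_eqVlt eq_sym (negPf (pt_gen _ _ _)) //=; first by rewrite /orient; lra.
- by rewrite eq_sym.
- by rewrite eq_sym.
Qed.

Lemma exposed_point (A B : {set T}) (i j : T) : i \in A -> j \in B ->
  pointed pt (pt i) B ->
  exists x, [/\ x \in A, x \notin B & pointed pt (pt x) ((A :|: B) :\ x)%SET].
Proof.
move=> iA jB /pointed_separation[a [b ab]].
(* [x] is lexicographically extremal in [A] for [(f, g)], hence exposed even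
   when several points attain the minimum of [f]. *)
pose f k := a * pt k 0 0 + b * pt k 0 1; pose g k := a * pt k 0 1 - b * pt k 0 0.
have fB k : k \in B -> f i < f k by move=> /ab; rewrite /f; lra.
pose r k l := (f k < f l) || ((f k == f l) && (g k <= g l)).
have [||| x xA xmin] := @seq_least T r (enum A).
- by apply/eqP => e; have := mem_enum A i; rewrite e iA.
- move=> k l _ _; rewrite /r; case: (ltgtP (f k) (f l)) => //= _; exact: le_total.
- move=> l k m _ _ _; rewrite /r => /orP[kl|/andP[/eqP kl g1]] /orP[lm|/andP[/eqP lm g2]].
  + by rewrite (lt_trans kl lm).
  + by rewrite -lm kl.
  + by rewrite kl lm.
  + by rewrite kl lm eqxx (le_trans g1 g2) orbT.
rewrite mem_enum in xA; exists x.
have xB : x \notin B.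
  apply/negP => /fB fix1; have := xmin i; rewrite mem_enum => /(_ iA).
  rewrite /r => /orP[|/andP[/eqP]]; lra.
(* The direction [(b, - a)] runs along the level lines of [f], so the test compares [f] first and
   [g] second. *)
split=> //; apply: (@lex_pointed _ _ b (- a)) => k.
rewrite finset.in_setD1 finset.in_setU => /andP[kx kAB] /=.
have fxi : f x <= f i.
  have := xmin i; rewrite mem_enum => /(_ iA); rewrite /r => /orP[|/andP[/eqP]]; lra.
have E1 : b * (pt k 0 1 - pt x 0 1) - - a * (pt k 0 0 - pt x 0 0) = f k - f x by rewrite /f; ring.
have E2 : b * (pt k 0 0 - pt x 0 0) + - a * (pt k 0 1 - pt x 0 1) = g x - g k by rewrite /g; ring.
rewrite E1 E2.
have [kB|kB] := boolP (k \in B).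
  left; have := fB k kB; lra.
move: kAB; rewrite (negPf kB) orbF => kA.
have := xmin k; rewrite mem_enum => /(_ kA); rewrite /r => /orP[|/andP[/eqP e g1]]; first by left; lra.
right; split; first lra.
(* The map [(f, g)] multiplies squared lengths by [a * a + b * b], which is nonzero because [f]
   differs at [i] and [j]; so a tie in both coordinates would force [k = x]. *)
have [e2|] := eqVneq (g x) (g k); last by rewrite neq_lt => /orP[]; lra.
have N : 0 < a * a + b * b.
  by apply: sumsq_gt0 => -[a0 b0]; have := fB j jB; rewrite /f a0 b0; lra.
have := mulr_gt0 N (sumsq_gt0 (@pt_neq x k _)); rewrite eq_sym => /(_ kx).
move: e e2; rewrite /f /g => e e2.
set u := pt k 0 0 - pt x 0 0; set v := pt k 0 1 - pt x 0 1.
have -> : (a * a + b * b) * (u * u + v * v) = (a * u + b * v) ^+ 2 + (a * v - b * u) ^+ 2 by ring.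
have -> : a * u + b * v = 0 by rewrite /u /v; lra.
have -> : a * v - b * u = 0 by rewrite /u /v; lra.
lra.
Qed.

Lemma transition_edge (A B : {set T}) (i j : T) :
  i \in A -> j \in B -> j \notin A -> pointed pt (pt i) B -> pointed pt (pt j) A ->
  exists x y, [/\ x \in A, x \notin B, y \in B &
    {in A :|: B, forall k, 0 <= orient (pt x) (pt y) (pt k)}]%SET.
Proof.
move=> iA jB jA /(exposed_point iA jB)[x0 [x0A x0B x0S]] /pointed_separation[a [b ab]].
(* [A] is in an open half-plane seen from [j], so the slope [g] orders it by
   angle around [j]; if the hull successor [z] of the extremal [x] were in
   [A \ B], its slope would be larger. *)
pose u k := pt k 0 0 - pt j 0 0; pose v k := pt k 0 1 - pt j 0 1.
pose f k := a * u k + b * v k; pose g k := (a * v k - b * u k) / f k.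
(* [Q] selects the vertices of the hull of the union that belong to [A] and not to [B]. *)
pose Q x := [&& x \in A, x \notin B & `[< pointed pt (pt x) ((A :|: B) :\ x)%SET >]].
have Qx0 : Q x0 by rewrite /Q x0A x0B; apply/asboolP.
case: (@arg_maxP _ _ _ x0 Q g Qx0) => x /and3P[xA xB /asboolP xS] xmax.
have jx : j != x by apply: contraNneq xB => <-.
have jS : j \in ((A :|: B) :\ x)%SET by rewrite finset.in_setD1 finset.in_setU jx jB orbT.
have [|z zS zleft] := pointed_right xS; first by apply/set0Pn; exists j.
move: (zS); rewrite finset.in_setD1 finset.in_setU => /andP[zx zAB].
have xz_left : {in A :|: B, forall k, 0 <= orient (pt x) (pt z) (pt k)}%SET.
  move=> k kS; have [->|kx] := eqVneq k x; last by apply: zleft; rewrite finset.in_setD1 kx.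
  by rewrite le_eqVlt; apply/orP; left; apply/eqP; rewrite /orient; ring.
have [zB|zB] := boolP (z \in B); first by exists x, z.
have zA : z \in A by move: zAB; rewrite (negPf zB) orbF.
have Qz : Q z.
  rewrite /Q zA zB; apply/asboolP; apply: successor_pointed xz_left.
  by rewrite eq_sym.
have zj : z != j by apply: contraNneq zB => ->.
have xzj : 0 < orient (pt x) (pt z) (pt j).
  by rewrite lt_neqAle zleft // eq_sym pt_gen // eq_sym.
have fx : 0 < f x by apply: ab.
have fz : 0 < f z by apply: ab.
have N : 0 < a * a + b * b.
  apply: sumsq_gt0 => -[a0 b0]; move: fx; rewrite /f a0 b0; lra.
(* With denominators cleared, [g z - g x] becomes [a * a + b * b] times the orientation of [x z j],
   hence is positive. *)
have : g z <= g x := xmax z Qz; rewrite /g ler_pdivrMr // mulrAC ler_pdivlMr //.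
have := mulr_gt0 N xzj; rewrite /f /u /v /orient; lra.
Qed.
End Existence.

(** * Convex hulls and the diagonal that cuts them *)

Lemma orient_conv (R : realType) (p q a b : 'rV[R]_2) (t : R) :
  orient p q (t *: a + (1 - t) *: b) = t * orient p q a + (1 - t) * orient p q b.
Proof. by rewrite /orient !mxE; ring. Qed.

Lemma convex_setP (R : realType) (V : lmodType R) (C : set V) :
  @convex_set R V C <->
  forall a b t, C a -> C b -> 0 <= t -> t <= 1 -> C (t *: a + (1 - t) *: b).
Proof.
split=> [CC a b t Ca Cb t0 t1|CC a b t].
  by have := CC a b (Itv01 t0 t1); rewrite !inE; exact.
rewrite !inE => Ca Cb; exact: CC.
Qed.

Lemma conv_hull_convex (R : realType) (A : set 'rV[R]_2) : @convex_set R 'rV[R]_2 (conv_hull A).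
Proof.
apply/convex_setP => a b t Aa Ab t0 t1 C [CC AC].
by move/convex_setP: (CC); apply => //; [exact: Aa|exact: Ab].
Qed.

Lemma conv_hull_left (R : realType) (A : set 'rV[R]_2) (p q r : 'rV[R]_2) :
  (forall a, A a -> 0 <= orient p q a) -> conv_hull A r -> 0 <= orient p q r.
Proof.
move=> pqA; move: r; apply: smallest_sub => //; apply/convex_setP => a b t a0 b0 t0 t1.
by rewrite /= orient_conv addr_ge0 // mulr_ge0 // subr_ge0.
Qed.

Lemma orient_continuous (R : realType) (p q : 'rV[R]_2) : continuous (orient p q).
Proof.
have c i (u : R) : continuous (fun s : 'rV[R]_2 => s 0 i - u).
  move=> r; apply: (@continuousB _ _ _ (fun s : 'rV[R]_2 => s 0 i) (cst u) r).
    exact: coord_continuous.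
  exact: cst_continuous.
move=> r.
apply: (@continuousB _ _ _ (fun s : 'rV[R]_2 => (q 0 0 - p 0 0) * (s 0 1 - p 0 1))
   (fun s : 'rV[R]_2 => (q 0 1 - p 0 1) * (s 0 0 - p 0 0)) r).
- apply: (@continuousM _ _ (cst (q 0 0 - p 0 0)) (fun s : 'rV[R]_2 => s 0 1 - p 0 1) r); [exact: cst_continuous|exact: c].
- apply: (@continuousM _ _ (cst (q 0 1 - p 0 1)) (fun s : 'rV[R]_2 => s 0 0 - p 0 0) r); [exact: cst_continuous|exact: c].
Qed.

(** On the line [q q'] the function [orient p q] is affine and vanishes at [q], so its ratio to its
    value at [q'] is the coordinate [t] of [r]. Being left of [p q] gives [0 <= t], being left of
    [p' q'] gives [t <= 1]. *)
Lemma segment_of_quadrilateral (R : realType) (p q p' q' r : 'rV[R]_2) :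
  0 < orient p q q' -> 0 < orient p' q' q ->
  orient q q' r = 0 -> 0 <= orient p q r -> 0 <= orient p' q' r ->
  exists t, [/\ 0 <= t, t <= 1 & r = t *: q' + (1 - t) *: q].
Proof.
move=> pqq pqq' qr pr pr'.
pose t := orient p q r / orient p q q'; exists t.
have tE : orient p q r = t * orient p q q' by rewrite /t divfK // gt_eqF.
have rE : r = t *: q' + (1 - t) *: q.
  have nz := gt_eqF pqq.
  apply: rV2_eq; rewrite !mxE; apply/eqP; rewrite -subr_eq0.
  - have : orient p q q' * (r 0 0 - (t * q' 0 0 + (1 - t) * q 0 0)) = 0.
      transitivity ((q' 0 0 - q 0 0) * (orient p q r - t * orient p q q')
        - (q 0 0 - p 0 0) * orient q q' r); first by rewrite /orient; ring.
      by rewrite tE qr subrr !mulr0 subrr.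
    by move/eqP; rewrite mulf_eq0 nz.
  - have : orient p q q' * (r 0 1 - (t * q' 0 1 + (1 - t) * q 0 1)) = 0.
      transitivity ((q' 0 1 - q 0 1) * (orient p q r - t * orient p q q')
        - (q 0 1 - p 0 1) * orient q q' r); first by rewrite /orient; ring.
      by rewrite tE qr subrr !mulr0 subrr.
    by move/eqP; rewrite mulf_eq0 nz.
split=> //; first by rewrite divr_ge0 // ltW.
move: pr'; rewrite rE orient_conv.
have -> : orient p' q' q' = 0 by rewrite /orient; ring.
by rewrite mulr0 add0r pmulr_lge0 // subr_ge0.
Qed.

(* The line [q q'] separates [p] from [p'] and meets the hull of [A] only inside
   the segment [q q'], which is in the hull of [B]. *)
Lemma transition_disconnects (R : realType) (A B : set 'rV[R]_2) (p q p' q' : 'rV[R]_2) :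
  A p -> A p' -> B q -> B q' -> ~ conv_hull B p -> ~ conv_hull B p' ->
  (forall a, A a -> 0 <= orient p q a) -> (forall a, A a -> 0 <= orient p' q' a) ->
  0 < orient p q p' -> 0 < orient p q q' -> 0 < orient p' q' p -> 0 < orient p' q' q ->
  ~ connected (conv_hull A `\` conv_hull B).
Proof.
move=> Ap Ap' Bq Bq' Bp Bp' pqA pqA' pqp' pqq' pqp pqq conn.
have sub (S : set 'rV[R]_2) s : S s -> conv_hull S s by exact: sub_gen_smallest.
(* The function [orient q q'] is positive at [p] and negative at [p'], so on a connected set it
   would vanish at some [r]. *)
have := connected_continuous_connected conn (continuous_subspaceT (@orient_continuous _ q q')).
move/connected_intervalP => /(_ (orient q q' p') (orient q q' p)).
have := sub _ _ Ap; have := sub _ _ Ap' => hp' hp.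
case/(_ _ _ 0) => [||| r [rA rB] r0]; [by exists p'|by exists p| |].
  by move: pqq' pqq; rewrite /orient; lra.
apply: rB; have [t [t0 t1 ->]] := segment_of_quadrilateral pqq' pqq r0 (conv_hull_left pqA rA) (conv_hull_left pqA' rA).
by move/convex_setP: (@conv_hull_convex _ B); apply=> //; exact: sub.
Qed.

(** Divided by the sum of its weights, a vanishing combination would exhibit [p] as a convex
    combination of three points of [C]. *)
Lemma hull_pointed (R : realType) (T : finType) (pt : T -> 'rV[R]_2) (C : set 'rV[R]_2)
    (A : {set T}) (p : 'rV[R]_2) :
  @convex_set R 'rV[R]_2 C -> {in A, forall i, C (pt i)} -> ~ C p -> pointed pt p A.
Proof.
move=> /convex_setP CC AC Cp j k l c1 c2 c3 /AC Cj /AC Ck /AC Cl h1 h2 h3 h e0 e1.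
apply: Cp; set s := c1 + c2 + c3 in h.
have comb2 : forall (a b : R) (x y : 'rV[R]_2), 0 <= a -> 0 <= b -> 0 < a + b -> C x -> C y ->
    C ((a + b)^-1 *: (a *: x + b *: y)).
  move=> a b x y a0 b0 ab Cx Cy.
  have -> : (a + b)^-1 *: (a *: x + b *: y) = (a / (a + b)) *: x + (1 - a / (a + b)) *: y.
    rewrite scalerDr !scalerA; congr (_ *: _ + _ *: _); first by rewrite mulrC.
    by field; rewrite gt_eqF.
  apply: CC => //; first by rewrite divr_ge0 // ltW.
  by rewrite ler_pdivrMr // mul1r lerDl.
(* The ternary combination is two nested binary ones; the inner one needs a positive total weight,
   and otherwise [p] is [pt l]. *)
have [c12|c12] := ltP 0 (c1 + c2).
- have := comb2 (c1 + c2) c3 ((c1 + c2)^-1 *: (c1 *: pt j + c2 *: pt k)) (pt l) (ltW c12) h3 h (comb2 _ _ _ _ h1 h2 c12 Cj Ck) Cl.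
  rewrite scalerA divff ?gt_eqF // scale1r.
  suff -> : (c1 + c2 + c3)^-1 *: (c1 *: pt j + c2 *: pt k + c3 *: pt l) = p by [].
  rewrite -/s; have s0 : s != 0 by rewrite gt_eqF.
  apply: (scalerI s0); rewrite scalerA divff ?gt_eqF // scale1r.
  by apply: rV2_eq; rewrite !mxE /s; lra.
- suff -> : p = pt l by [].
  have [z1 z2] : c1 = 0 /\ c2 = 0 by split; lra.
  have z3 : c3 != 0 by rewrite gt_eqF //; move: h; rewrite /s; lra.
  apply: rV2_eq; apply: (mulfI z3); move: e0 e1; rewrite z1 z2; lra.
Qed.

(* The incidence product of [U] and [V] is [J - I], which is invertible. *)
Lemma rank_bound (R : realType) (I J : finType) (U V : I -> {pred J}) :
  (1 < #|I|)%N ->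
  (forall a b, #|[pred j | (j \in U a) && (j \in V b)]| = (a != b)) ->
  (#|I| <= #|J|)%N.
Proof.
move=> I1 UV.
pose MU : 'M[R]_(#|I|, #|J|) := \matrix_(a, j) (enum_val j \in U (enum_val a))%:R.
pose MV : 'M[R]_(#|J|, #|I|) := \matrix_(j, b) (enum_val j \in V (enum_val b))%:R.
have ME : MU *m MV = const_mx 1 - 1%:M.
  apply/matrixP => a b; rewrite !mxE.
  under eq_bigr do rewrite !mxE -natrM mulnb.
  rewrite -(big_enum_val (fun j => ((j \in U (enum_val a)) && (j \in V (enum_val b)))%:R)) /=.
  rewrite -natr_sum -big_mkcond sum1_card UV (inj_eq enum_val_inj).
  by case: eqP; rewrite ?subrr ?subr0.
have free : row_free (MU *m MV).
  apply: inj_row_free => v; rewrite ME mulmxBr mulmx1 => /eqP; rewrite subr_eq0 => /eqP e.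
  (* A kernel vector satisfies [v J = v], so all its entries equal their sum [s]; then [s] is [#|I|]
     times itself, hence zero. *)
  pose s := \sum_i v 0 i.
  have vs i : v 0 i = s.
    rewrite -e mxE; apply: eq_bigr => k _; by rewrite mxE mulr1.
  have : s = s *+ #|I|.
    by rewrite {1}/s (eq_bigr (fun=> s)) // sumr_const card_ord.
  rewrite -[LHS]mulr1n => /eqP; rewrite eq_sym -subr_eq0 -mulrnBr ?(ltnW I1) // mulrn_eq0 subn_eq0 leqNgt I1 /= => /eqP s0.
  by apply/rowP => i; rewrite vs s0 mxE.
rewrite -[X in (X <= _)%N](eqP free); apply: leq_trans (mxrankM_maxl _ _) _.
exact: rank_leq_col.
Qed.

Lemma orient0_collinear (R : realType) (a b c : 'rV[R]_2) :
  a != b -> orient a b c = 0 -> collinear [set a; b; c].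
Proof.
move=> ab abc; exists a, (b - a); split; first by rewrite subr_eq0 eq_sym.
set u := b 0 0 - a 0 0; set v := b 0 1 - a 0 1.
have N : 0 < u * u + v * v.
  apply: sumsq_gt0 => -[u0 v0]; move/eqP: ab; apply.
  by apply: rV2_eq; apply/eqP; rewrite eq_sym -subr_eq0 ?u0 ?v0 // -/v -/u ?u0 ?v0.
move=> x [[->|->]|->].
- by exists 0; rewrite scale0r addr0.
- by exists 1; rewrite scale1r addrC subrK.
(* Orthogonal projection of [c - a] onto [b - a]; the vanishing orientation says that nothing is
   lost. *)
- pose t := (u * (c 0 0 - a 0 0) + v * (c 0 1 - a 0 1)) / (u * u + v * v); exists t.
  have tN : t * (u * u + v * v) = u * (c 0 0 - a 0 0) + v * (c 0 1 - a 0 1).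
    by rewrite /t divfK ?lt0r_neq0.
  move: abc; rewrite /orient -/u -/v => abc.
  apply: rV2_eq; rewrite !mxE -/u -/v; apply: (mulfI (lt0r_neq0 N)); apply/eqP; rewrite -subr_eq0.
  + have -> : (u * u + v * v) * c 0 0 - (u * u + v * v) * (a 0 0 + t * u) =
      - u * (t * (u * u + v * v)) + (u * u + v * v) * (c 0 0 - a 0 0) by ring.
    apply/eqP; rewrite tN; transitivity (- v * (u * (c 0 1 - a 0 1) - v * (c 0 0 - a 0 0))); first by ring.
    by rewrite abc mulr0.
  + have -> : (u * u + v * v) * c 0 1 - (u * u + v * v) * (a 0 1 + t * v) =
      - v * (t * (u * u + v * v)) + (u * u + v * v) * (c 0 1 - a 0 1) by ring.
    apply/eqP; rewrite tN; transitivity (u * (u * (c 0 1 - a 0 1) - v * (c 0 0 - a 0 0))); first by ring.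
    by rewrite abc mulr0.
Qed.

(** The right side exceeds the left by the square of [n - 1]. *)
Lemma sqrn_leq_bin2 n : (n * n <= 4 * 'C(n, 2) + 1)%N.
Proof.
case: n => // k; have := mul_bin_diag k.+1 1; rewrite bin1 /=; nia.
Qed.

(** * Counting transition edges between index sets *)

Section Counting.
Variables (R : realType) (T : finType) (pt : T -> 'rV[R]_2) (Fs : {set {set T}}).
Hypothesis pt_inj : injective pt.
Hypothesis pt_gen : forall i j k, i != j -> j != k -> i != k ->
  orient (pt i) (pt j) (pt k) != 0.
Let hull (I : {set T}) := conv_hull (pt @` [set` I]).
Hypothesis hull_trace : forall I i, I \in Fs -> hull I (pt i) -> i \in I.
Hypothesis Fs_anti : forall I J, I \in Fs -> J \in Fs -> I != J -> ~~ (I \subset J).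
Hypothesis Fs_conn : forall I J, I \in Fs -> J \in Fs -> I != J ->
  connected (hull I `\` hull J).

Definition left_of (x y : T) (I : {set T}) :=
  [forall k in I, 0 <= orient (pt x) (pt y) (pt k)].
(** The transition condition is split into a part on [I] and a part on [J], as a matrix product
    requires. Degenerate pairs [(x, x)] may occur here but never in [head_edge]. *)
Definition tail_edge (I : {set T}) : {pred T * T} :=
  [pred e | (e.1 \in I) && left_of e.1 e.2 I].
Definition head_edge (J : {set T}) : {pred T * T} :=
  [pred e | [&& e.1 \notin J, e.2 \in J & left_of e.1 e.2 J]].

Lemma orient_gt0 i j k (I : {set T}) : left_of i j I -> k \in I -> i != j -> k != i -> k != j ->
  0 < orient (pt i) (pt j) (pt k).
Proof.
move=> /forall_inP ijI kI ij ki kj; rewrite lt_neqAle ijI // andbT eq_sym pt_gen //.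
- by rewrite eq_sym.
- by rewrite eq_sym.
Qed.

Lemma hull_pt (I : {set T}) i : i \in I -> hull I (pt i).
Proof. by move=> iI; apply: sub_gen_smallest; exists i. Qed.

Lemma transition_edge_exists I J : I \in Fs -> J \in Fs -> I != J ->
  exists e, (e \in tail_edge I) && (e \in head_edge J).
Proof.
move=> IF JF IJ.
have /subsetPn[i iI iJ] := Fs_anti IF JF IJ.
have /subsetPn[j jJ jI] : ~~ (J \subset I) by rewrite Fs_anti // eq_sym.
have hp K k : K \in Fs -> k \notin K -> pointed pt (pt k) K.
  move=> KF kK; apply: (@hull_pointed _ _ _ (hull K)); first exact: conv_hull_convex.
    by move=> l; exact: hull_pt.
  by move/(hull_trace KF); apply/negP.
have [x [y [xI xJ yJ xy]]] := transition_edge pt_inj pt_gen iI jJ jI (hp _ _ JF iJ) (hp _ _ IF jI).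
exists (x, y); rewrite !inE /= xI xJ yJ /=; apply/andP; split.
  by apply/forall_inP => k kI; apply: xy; rewrite finset.in_setU kI.
by apply/forall_inP => k kJ; apply: xy; rewrite finset.in_setU kJ orbT.
Qed.

Lemma transition_edge_unique I J e e' : I \in Fs -> J \in Fs -> I != J ->
  e \in tail_edge I -> e \in head_edge J -> e' \in tail_edge I -> e' \in head_edge J ->
  e = e'.
Proof.
case: e e' => [x y] [x' y'] IF JF IJ; rewrite !inE /=.
move=> /andP[xI xyI] /and3P[xJ yJ xyJ] /andP[xI' xyI'] /and3P[xJ' yJ' xyJ'].
have ne k l : k \in J -> l \notin J -> k != l by move=> kJ; apply: contraNneq => <-.
have ne' k l : k \in J -> l \notin J -> l != k by move=> kJ lJ; rewrite eq_sym ne.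
have [ex|ex] := eqVneq x x'; have [ey|ey] := eqVneq y y'.
- by rewrite ex ey.
(* Common tail: [y'] would be strictly left of [x y] and [y] strictly left of [x y'], which have
   opposite signs. *)
- exfalso; subst x'; have := orient_gt0 xyJ yJ' (ne' _ _ yJ xJ) (ne _ _ yJ' xJ).
  have := orient_gt0 xyJ' yJ (ne' _ _ yJ' xJ) (ne _ _ yJ xJ) ey.
  rewrite eq_sym => h /(_ ey); move: h; rewrite orient_anti; lra.
(* Common head: the same sign conflict, now between [x] and [x'], both in [I]. *)
- exfalso; subst y'; have := orient_gt0 xyI xI' (ne' _ _ yJ xJ).
  rewrite eq_sym => /(_ ex (ne' _ _ yJ xJ')).
  have := orient_gt0 xyI' xI (ne' _ _ yJ xJ') ex (ne' _ _ yJ xJ).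
  rewrite /orient; lra.
- exfalso; apply: (@transition_disconnects _ (pt @` [set` I]) (pt @` [set` J])
    (pt x) (pt y) (pt x') (pt y') _ _ _ _ _ _ _ _ _ _ _ _ (Fs_conn IF JF IJ)).
  + by exists x.
  + by exists x'.
  + by exists y.
  + by exists y'.
  + by move/(hull_trace JF); apply/negP.
  + by move/(hull_trace JF); apply/negP.
  + by move=> _ [k kI <-]; move/forall_inP: xyI; apply.
  + by move=> _ [k kI <-]; move/forall_inP: xyI'; apply.
  + by apply: (orient_gt0 xyI) => //; [exact: ne'|rewrite eq_sym|exact: ne'].
  + by apply: (orient_gt0 xyJ) => //; [exact: ne'|exact: ne|rewrite eq_sym].
  + by apply: (orient_gt0 xyI') => //; exact: ne'.
  + by apply: (orient_gt0 xyJ') => //; [exact: ne'|exact: ne].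
Qed.

Lemma card_Fs : (1 < #|Fs|)%N -> (#|Fs| <= #|T| * #|T|)%N.
Proof.
move=> F1; rewrite -card_prod.
have cF : #|{: {I | I \in Fs}}| = #|Fs| by rewrite card_sig; apply: eq_card => I; rewrite inE.
rewrite -cF in F1 *.
apply: (rank_bound R (U := fun I => tail_edge (val I)) (V := fun I => head_edge (val I)) F1).
move=> [I IF] [J JF]; rewrite -val_eqE /=.
have [<-|IJ] := eqVneq I J.
  (* On the diagonal the tail would have to lie both in and outside the same set. *)
  by apply: eq_card0 => e; rewrite !inE; case: (e.1 \in I); rewrite ?andbF.
have [e /andP[eI eJ]] := transition_edge_exists IF JF IJ.
apply: (@fintype.eq_card1 _ e) => f; rewrite [LHS]inE /= [RHS]inE.
apply/idP/eqP => [/andP[fI fJ]|->]; last by rewrite eI eJ.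
exact: transition_edge_unique fI fJ eI eJ.
Qed.

End Counting.

Theorem theorem2 (R : realType) (n : nat) (P : set 'rV[R]_2)
    (F : set (set 'rV[R]_2)) :
  P #= `I_n ->
  general_position P ->
  convex_pseudo_discs P F ->
  (forall A B, F A -> F B -> A <> B -> ~ (A `<=` B)) ->
  F #<= `I_(4 * 'C(n, 2) + 1).
Proof.
move=> Pn genP [F_conv F_conn] F_anti.
have /card_set_bijP[pt [/= ptP pt_in pt_surj]] : [set: 'I_n] #= P.
  by rewrite card_eq_sym (card_eql Pn) card_II.
have pt_inj : injective pt by move=> i j; apply: pt_in; rewrite inE.
have ptPi i : P (pt i) by apply: ptP.
pose S (I : {set 'I_n}) : set 'rV[R]_2 := pt @` [set` I].
have S_mem I i : S I (pt i) -> i \in I by case=> j jI /pt_inj <-.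
have S_inj : injective S.
  move=> I J e; apply/setP => i.
  by apply/idP/idP => h; apply: S_mem; [rewrite -e|rewrite e]; exists i.
pose Fs := [set I | `[< F (S I) >]]%SET.
have FsP I : I \in Fs -> F (S I) by rewrite inE => /asboolP.
(* Every member is a trace on [P], hence determined by its indices; this makes [F] finite. *)
have F_image : F `<=` (fun k : 'I_#|Fs| => S (enum_val k)) @` setT.
  move=> A FA; have [C CC AC] := F_conv A FA.
  pose I := [set i | `[< A (pt i) >]]%SET.
  have SI : S I = A.
    apply/seteqP; split=> [_ [i /= iI <-]|p Ap].
      by move: iI; rewrite inE => /asboolP.
    have /pt_surj[i _ ip] : P p by move: Ap; rewrite AC => -[].
    by exists i => //=; rewrite inE; apply/asboolP; rewrite ip.
  have IF : I \in Fs by rewrite inE; apply/asboolP; rewrite SI.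
  by exists (enum_rank_in IF I) => //; rewrite enum_rankK_in.
apply: (card_le_trans (subset_card_le F_image)).
apply: (card_le_trans (card_image_le _ _)).
rewrite -(card_le_eql card_II) card_le_II.
(* For one member the matrix [J - I] is zero and gives no bound; the summand 1 covers this case. *)
have [F1|F1] := leqP #|Fs| 1; first by rewrite (leq_trans F1) // addn1.
apply: (@leq_trans (n * n)); last exact: sqrn_leq_bin2.
rewrite -[X in (_ <= X * X)%N]card_ord.
apply: (card_Fs pt_inj) F1.
- move=> i j k ij jk ik; apply/eqP => o0.
  have ne i1 i2 : i1 != i2 -> pt i1 != pt i2 by rewrite (inj_eq pt_inj).
  by apply: (genP (pt i) (pt j) (pt k)); rewrite ?ne //; apply: orient0_collinear; rewrite ?ne.
(* The hull of a trace [P] intersected with [C] stays inside [C], so it contains no further point of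
   [P]. *)
- move=> I i /FsP FI Ii; have [C CC SC] := F_conv _ FI.
  have SIC : S I `<=` C by rewrite SC => p [].
  by apply: S_mem; rewrite SC; split; [|apply: Ii].
- move=> I J /FsP FI /FsP FJ /eqP IJ; apply/negP => /fintype.subsetP sub.
  by apply: (F_anti _ _ FI FJ) => [/S_inj//|_ [i /sub iJ <-]]; exists i.
- move=> I J /FsP FI /FsP FJ /eqP IJ.
  by have [|] := F_conn _ _ FI FJ _; first by move/S_inj.
Qed.
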